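(* Let $\mathfrak{g}$ be a real semisimple Lie algebra. Every irreducible $\mathbb{H}$-representation $(\rho,J)$ of $\mathfrak{g}$ is, up to equivalence, one of the following: (1) $\rho$ is a quaternionic irreducible $\mathbb{C}$-representation and $J=J_\rho$; (2) $\rho=\phi\oplus\overline{\phi}$, where $\phi$ is a real or not self-conjugated irreducible $\mathbb{C}$-representation, and $J=J_{\mathbb{H}}$. Every irreducible $\mathbb{R}$-representation $(\rho,J)$ of $\mathfrak{g}$ is, up to equivalence, one of the following: (1) $\rho$ is a real irreducible $\mathbb{C}$-representation and $J=J_\rho$; (2) $\rho=\phi\oplus\overline{\phi}$, where $\phi$ is a quaternionic or not self-conjugated irreducible $\mathbb{C}$-representation, and $J=J_{\mathbb{R}}$.
   Context: All representations are finite dimensional. A $\mathbb{C}$-representation is an $\mathbb{R}$-linear Lie algebra homomorphism $\rho:\mathfrak{g}\to\mathrm{End}_{\mathbb{C}}(V)$. An antiinvolution of the first (resp. second) kind on $\rho$ is a $\rho$-equivariant antilinear map $J:V\to V$ with $J^2=1$ (resp. $J^2=-1$). $\mathbb{R}$-representations (resp. $\mathbb{H}$-representations), i.e. Lie algebra homomorphisms into $\mathrm{End}_{\mathbb{R}}(W)$ (resp. $\mathrm{End}_{\mathbb{H}}(W)$), are regarded as pairs $(\rho,J)$ of a $\mathbb{C}$-representation and an antiinvolution of the first (resp. second) kind on it (for $\mathbb{R}$: $V=W\otimes_{\mathbb{R}}\mathbb{C}$ with $J$ complex conjugation; for $\mathbb{H}$: $V=W$ as a complex space with $J$ multiplication by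 $j$). $(\rho_1,J_1)$ and $(\rho_2,J_2)$ are equivalent if there is an equivariant $\mathbb{C}$-linear isomorphism $f$ with $f\circ J_1=J_2\circ f$. $(\rho,J)$ is irreducible if it is non-zero and has no non-zero proper $\rho$- and $J$-invariant complex subspace. A $\mathbb{C}$-representation is real (resp. quaternionic) if it admits an antiinvolution of the first (resp. second) kind. The conjugate $\overline{\rho}$ of $\rho$ is given by the same operators on the complex conjugate vector space $\overline V$ (scalar multiplication $z*v=\overline z v$); $\rho$ is self-conjugated if $\rho\cong\overline{\rho}$ as $\mathbb{C}$-representations. For an irreducible $\mathbb{C}$-representation $\rho$ admitting an antiinvolution, $J_\rho$ denotes that antiinvolution (it is unique up to equivalence). For a $\mathbb{C}$-representation $\phi$ on $V$, the antiinvolutions $J_{\mathbb{R}},J_{\mathbb{H}}$ on $\phi\oplus\overline{\phi}$ are $J_{\mathbb{R}}(v_1,v_2)=(v_2,v_1)$ and $J_{\mathbb{H}}(v_1,v_2)=(-v_2,v_1)$ for $(v_1,v_2)\in V\oplus\overline V$. *)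

(* Defs.v *)
From HB Require Import structures.
From mathcomp Require Import all_boot all_order all_algebra.
From mathcomp Require Import complex.
From mathcomp Require Import reals.

Set Implicit Arguments.
Unset Strict Implicit.
Unset Printing Implicit Defensive.

Import GRing.Theory VectorInternalTheory.
Local Open Scope ring_scope.
Local Open Scope complex_scope.

(** * Finite-dimensional Lie algebras *)

HB.mixin Record Vector_isLie (F : fieldType) (L : Type) of Vector F L := {
  lie : L -> L -> L;
  lieDZl : forall (a : F) (x y z : L),
    lie (a *: x + y) z = a *: lie x z + lie y z;
  lieDZr : forall (a : F) (x y z : L),
    lie z (a *: x + y) = a *: lie z x + lie z y;
  liexx : forall x : L, lie x x = 0;
  lie_jacobi : forall x y z : L,
    lie x (lie y z) + lie y (lie z x) + lie z (lie x y) = 0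
}.

#[short(type="lieAlgType")]
HB.structure Definition LieAlgebra (F : fieldType) :=
  { L of Vector_isLie F L & Vector F L }.

Definition lie_ideal (F : fieldType) (L : lieAlgType F) (I : {vspace L}) : Prop :=
  forall x y : L, y \in I -> lie x y \in I.

(* By bilinearity, the brackets of a basis span [U, U]. *)
Definition lie_derived (F : fieldType) (L : lieAlgType F) (U : {vspace L}) :
    {vspace L} :=
  <<[seq lie x y | x <- vbasis U, y <- vbasis U]>>%VS.

Definition lie_solvable (F : fieldType) (L : lieAlgType F) (U : {vspace L}) :
    Prop :=
  exists n : nat, iter n (@lie_derived F L) U = 0%VS.

(* The radical, i.e. the largest solvable ideal, is zero. *)
Definition semisimple (F : fieldType) (L : lieAlgType F) : Prop :=
  forall I : {vspace L}, lie_ideal I -> lie_solvable I -> I = 0%VS.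

(** * The complex conjugate of a complex vector space *)

Definition conj_space (R : realType) (V : vectType R[i]) : Type := V.

HB.instance Definition _ (R : realType) (V : vectType R[i]) :=
  GRing.Zmodule.on (@conj_space R V).

Definition conj_scale (R : realType) (V : vectType R[i]) (z : R[i])
  (v : conj_space V) : conj_space V := conjc z *: (v : V).

Fact conj_scaleA (R : realType) (V : vectType R[i]) (a b : R[i])
  (v : conj_space V) : conj_scale a (conj_scale b v) = conj_scale (a * b) v.
Proof. by rewrite /conj_scale scalerA rmorphM. Qed.

Fact conj_scale1 (R : realType) (V : vectType R[i]) :
  left_id 1 (@conj_scale R V).
Proof. by move=> v; rewrite /conj_scale rmorph1 scale1r. Qed.

Fact conj_scaleDr (R : realType) (V : vectType R[i]) :
  right_distributive (@conj_scale R V) +%R.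
Proof. by move=> a u v; rewrite /conj_scale scalerDr. Qed.

Fact conj_scaleDl (R : realType) (V : vectType R[i]) (v : conj_space V) :
  {morph (@conj_scale R V)^~ v : a b / a + b}.
Proof. by move=> a b; rewrite /conj_scale rmorphD scalerDl. Qed.

HB.instance Definition _ (R : realType) (V : vectType R[i]) :=
  GRing.Zmodule_isLmodule.Build R[i] (conj_space V)
    (@conj_scaleA R V) (@conj_scale1 R V) (@conj_scaleDr R V)
    (@conj_scaleDl R V).

Fact conj_scaleE (R : realType) (V : vectType R[i]) (z : R[i])
  (v : conj_space V) : z *: v = conjc z *: (v : V).
Proof. by []. Qed.

Fact conj_space_vect_iso (R : realType) (V : vectType R[i]) :
  Vector.axiom (dim V) (conj_space V).
Proof.
exists (fun v : conj_space V => map_mx conjc (v2r (v : V))).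
  move=> a u v; apply/rowP=> i.
  by rewrite conj_scaleE linearP !mxE rmorphD rmorphM /= conjcK.
exists (fun w => r2v (map_mx conjc w) : V) => [v | w].
  rewrite -[RHS]v2rK; congr r2v; apply/rowP=> i; by rewrite !mxE conjcK.
by rewrite r2vK; apply/rowP=> i; rewrite !mxE conjcK.
Qed.

HB.instance Definition _ (R : realType) (V : vectType R[i]) :=
  Lmodule_hasFinDim.Build R[i] (conj_space V) (conj_space_vect_iso V).

(** * Complex representations of a real Lie algebra *)

Record crep (R : realType) (g : lieAlgType R) (V : vectType R[i]) := CRep {
  crep_fun :> g -> 'End(V);
  crep_linear : forall (a : R) (x y : g),
    crep_fun (a *: x + y) = a%:C *: crep_fun x + crep_fun y;
  crep_lie : forall x y : g,
    crep_fun (lie x y) =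
      (crep_fun x \o crep_fun y)%VF - (crep_fun y \o crep_fun x)%VF
}.

Definition rep_invariant (R : realType) (g : lieAlgType R) (V : vectType R[i])
    (rho : crep g V) (U : {vspace V}) : Prop :=
  forall (x : g) (v : V), v \in U -> rho x v \in U.

Definition rep_irreducible (R : realType) (g : lieAlgType R)
    (V : vectType R[i]) (rho : crep g V) : Prop :=
  {:V}%VS <> 0%VS /\
  forall U : {vspace V}, rep_invariant rho U -> U = 0%VS \/ U = {:V}%VS.

Definition rep_equiv (R : realType) (g : lieAlgType R) (V W : vectType R[i])
    (rho : crep g V) (sigma : crep g W) : Prop :=
  exists f : 'Hom(V, W),
    bijective f /\ forall (x : g) (v : V), f (rho x v) = sigma x (f v).

Definition conj_lfun (R : realType) (V : vectType R[i]) (f : 'End(V)) :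
    conj_space V -> conj_space V := f.

Fact conj_lfun_linear (R : realType) (V : vectType R[i]) (f : 'End(V)) :
  linear (conj_lfun f).
Proof. by move=> a u v; exact: (linearP f). Qed.

HB.instance Definition _ (R : realType) (V : vectType R[i]) (f : 'End(V)) :=
  GRing.isLinear.Build R[i] (conj_space V) (conj_space V) _ (conj_lfun f)
    (@conj_lfun_linear R V f).

Definition conj_rep_fun (R : realType) (g : lieAlgType R) (V : vectType R[i])
    (rho : crep g V) (x : g) : 'End(conj_space V) := linfun (conj_lfun (rho x)).

Fact conj_rep_linear (R : realType) (g : lieAlgType R) (V : vectType R[i])
    (rho : crep g V) (a : R) (x y : g) :
  conj_rep_fun rho (a *: x + y) =
    a%:C *: conj_rep_fun rho x + conj_rep_fun rho y.
Proof.
apply/lfunP=> v; rewrite add_lfunE scale_lfunE !lfunE /= /conj_lfun.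
rewrite crep_linear add_lfunE scale_lfunE.
by rewrite [in RHS]conj_scaleE conjc_real.
Qed.

Fact conj_rep_lie (R : realType) (g : lieAlgType R) (V : vectType R[i])
    (rho : crep g V) (x y : g) :
  conj_rep_fun rho (lie x y) =
    (conj_rep_fun rho x \o conj_rep_fun rho y)%VF -
    (conj_rep_fun rho y \o conj_rep_fun rho x)%VF.
Proof.
apply/lfunP=> v; rewrite add_lfunE opp_lfunE !comp_lfunE !lfunE /= /conj_lfun.
by rewrite crep_lie add_lfunE opp_lfunE !comp_lfunE.
Qed.

Definition conj_rep (R : realType) (g : lieAlgType R) (V : vectType R[i])
    (rho : crep g V) : crep g (conj_space V) :=
  CRep (conj_rep_linear rho) (conj_rep_lie rho).

Definition self_conjugated (R : realType) (g : lieAlgType R)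
    (V : vectType R[i]) (rho : crep g V) : Prop :=
  rep_equiv rho (conj_rep rho).

Definition pair_lfun (R : realType) (V W : vectType R[i]) (f : 'End(V))
  (h : 'End(W)) (u : V * W) : V * W := (f u.1, h u.2).

Fact pair_lfun_linear (R : realType) (V W : vectType R[i]) (f : 'End(V))
  (h : 'End(W)) : linear (pair_lfun f h).
Proof. by move=> a u v; rewrite /pair_lfun /= !linearP. Qed.

HB.instance Definition _ (R : realType) (V W : vectType R[i]) (f : 'End(V))
    (h : 'End(W)) :=
  GRing.isLinear.Build R[i] (V * W)%type (V * W)%type _ (pair_lfun f h)
    (@pair_lfun_linear R V W f h).

Definition dsum_rep_fun (R : realType) (g : lieAlgType R)
    (V W : vectType R[i]) (rho : crep g V) (sigma : crep g W) (x : g) :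
    'End((V * W)%type) := linfun (pair_lfun (rho x) (sigma x)).

Fact dsum_rep_linear (R : realType) (g : lieAlgType R) (V W : vectType R[i])
    (rho : crep g V) (sigma : crep g W) (a : R) (x y : g) :
  dsum_rep_fun rho sigma (a *: x + y) =
    a%:C *: dsum_rep_fun rho sigma x + dsum_rep_fun rho sigma y.
Proof.
apply/lfunP=> v; rewrite add_lfunE scale_lfunE !lfunE /= /pair_lfun.
by rewrite !crep_linear !add_lfunE !scale_lfunE.
Qed.

Fact dsum_rep_lie (R : realType) (g : lieAlgType R) (V W : vectType R[i])
    (rho : crep g V) (sigma : crep g W) (x y : g) :
  dsum_rep_fun rho sigma (lie x y) =
    (dsum_rep_fun rho sigma x \o dsum_rep_fun rho sigma y)%VF -
    (dsum_rep_fun rho sigma y \o dsum_rep_fun rho sigma x)%VF.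
Proof.
apply/lfunP=> v; rewrite add_lfunE opp_lfunE !comp_lfunE !lfunE /= /pair_lfun.
by rewrite !crep_lie !add_lfunE !opp_lfunE !comp_lfunE.
Qed.

Definition dsum_rep (R : realType) (g : lieAlgType R) (V W : vectType R[i])
    (rho : crep g V) (sigma : crep g W) : crep g (V * W)%type :=
  CRep (dsum_rep_linear rho sigma) (dsum_rep_lie rho sigma).

(** * Antiinvolutions *)

Variant antiinvolution_kind := FirstKind | SecondKind.

Definition antilinear (R : realType) (V : vectType R[i]) (J : V -> V) : Prop :=
  forall (z : R[i]) (u v : V), J (z *: u + v) = conjc z *: J u + J v.

Definition antiinvolution (k : antiinvolution_kind) (R : realType)
    (g : lieAlgType R) (V : vectType R[i]) (rho : crep g V) (J : V -> V) :
    Prop :=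
  [/\ antilinear J,
      forall (x : g) (v : V), J (rho x v) = rho x (J v) &
      forall v : V,
        J (J v) = match k with FirstKind => v | SecondKind => - v end].

Definition real_rep (R : realType) (g : lieAlgType R) (V : vectType R[i])
    (rho : crep g V) : Prop :=
  exists J : V -> V, antiinvolution FirstKind rho J.

Definition quaternionic_rep (R : realType) (g : lieAlgType R)
    (V : vectType R[i]) (rho : crep g V) : Prop :=
  exists J : V -> V, antiinvolution SecondKind rho J.

(** * Representations over the reals and the quaternions *)

(* An R-representation (resp. H-representation) is a pair (rho, J) where J is
   an antiinvolution of the first (resp. second) kind on rho. *)
Definition is_Rrep (R : realType) (g : lieAlgType R) (V : vectType R[i])
    (rho : crep g V) (J : V -> V) : Prop := antiinvolution FirstKind rho J.

Definition is_Hrep (R : realType) (g : lieAlgType R) (V : vectType R[i])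
    (rho : crep g V) (J : V -> V) : Prop := antiinvolution SecondKind rho J.

Definition pair_irreducible (R : realType) (g : lieAlgType R)
    (V : vectType R[i]) (rho : crep g V) (J : V -> V) : Prop :=
  {:V}%VS <> 0%VS /\
  forall U : {vspace V}, rep_invariant rho U ->
    (forall v : V, v \in U -> J v \in U) -> U = 0%VS \/ U = {:V}%VS.

Definition pair_equiv (R : realType) (g : lieAlgType R) (V W : vectType R[i])
    (rho : crep g V) (J : V -> V) (sigma : crep g W) (K : W -> W) : Prop :=
  exists f : 'Hom(V, W),
    [/\ bijective f,
        forall (x : g) (v : V), f (rho x v) = sigma x (f v) &
        forall v : V, f (J v) = K (f v)].

(* "J = J_rho": J is an antiinvolution on rho, and it is the only one, of
   either kind, up to equivalence. *)
Definition is_Jrho (R : realType) (g : lieAlgType R) (V : vectType R[i])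
    (rho : crep g V) (J : V -> V) : Prop :=
  (exists k : antiinvolution_kind, antiinvolution k rho J) /\
  forall (k : antiinvolution_kind) (K : V -> V),
    antiinvolution k rho K -> pair_equiv rho J rho K.

(* The swaps below go through the identity of the underlying set of V and
   conj_space V, which are convertible. *)
Definition J_R (R : realType) (V : vectType R[i]) (u : V * conj_space V) :
    V * conj_space V := ((u.2 : V), (u.1 : conj_space V)).

Definition J_H (R : realType) (V : vectType R[i]) (u : V * conj_space V) :
    V * conj_space V := (- (u.2 : V), (u.1 : conj_space V)).

(* Main.v *)
Require Import Defs.
From HB Require Import structures.
From mathcomp Require Import all_boot all_order all_algebra.
From mathcomp Require Import complex.
From mathcomp Require Import reals.
From mathcomp Require Import spectral lra.
From Stdlib Require Import Classical.

Set Implicit Arguments.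
Unset Strict Implicit.
Unset Printing Implicit Defensive.

Import GRing.Theory Num.Theory.
Local Open Scope ring_scope.
Local Open Scope complex_scope.

(** Let [(rho, J)] be an irreducible pair of kind [k], so that
    [J (J v) = eps v] with [eps = 1] or [eps = -1] according to [k]. The same
    argument treats both kinds.

    If [rho] is itself irreducible, the pair is of type (1), and what has to be
    seen is that [J] is the only antiinvolution on [rho], up to equivalence.
    For another one [K], the map [K o J] is complex linear and equivariant,
    hence a scalar by Schur's lemma, so [K = m J]. Computing [K o K] gives
    [|m|^2 = 1] and the same kind for [K]. A number of modulus one has the form
    [n / conj n] (the easy case of Hilbert 90), and multiplication by [n] is
    then an equivalence from [J] to [K]
    ([irreducible_antiinvolution_unique]).

    If [rho] is reducible, choose a minimal non-zero invariant subspace [U]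
    and let [phi] be the restriction of [rho] to it. Both the intersection of
    [U] with [J U] and the sum [U + J U] are invariant under [rho] and [J], so
    the first is zero and the second is everything. As [J] is antilinear,
    [J U] is a copy of the conjugate of [phi], and
    [(u1, u2) |-> u1 + J u2] identifies the pair with [phi + conj phi] carrying
    its standard antiinvolution of kind [k] ([pair_equiv_dsum]).

    It remains to constrain [phi] when it is self-conjugated. An isomorphism
    with its conjugate is an invertible equivariant antilinear map [A] on [U];
    [A o A] is a scalar, which is real because it commutes with [A], and
    rescaling [A] turns it into an antiinvolution
    ([self_conjugated_antiinvolution]). Its kind cannot be [k]: otherwise the
    graph of [J o A], that is the set of all [u + J (A u)], would be a proper
    non-zero subspace invariant under [rho] and [J]
    ([sub_rep_opposite_kind]). *)

(** * Linear algebra *)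

(** Turns the explicit formulas used below, such as composites of two
    antilinear maps, into bundled maps with a kernel and an image. *)
Lemma linear_lfun (F : fieldType) (U V : vectType F) (f : U -> V) :
  linear f -> exists h : 'Hom(U, V), h =1 f.
Proof.
move=> lf.
pose f' : {linear U -> V} := HB.pack f (GRing.isLinear.Build F U V _ f lf).
by exists (linfun f') => u; rewrite lfunE.
Qed.

Lemma lfun_bijective (F : fieldType) (U V : vectType F) (f : 'Hom(U, V)) :
  injective f -> limg f = {:V}%VS -> bijective f.
Proof.
move=> /lker0P kf imf; exists (f^-1)%VF; first exact: lker0_lfunK.
by move=> v; rewrite limg_lfunVK // imf memvf.
Qed.

Lemma fullv_neq0_ex (F : fieldType) (V : vectType F) :
  {:V}%VS <> 0%VS -> exists v : V, v != 0.
Proof. by move=> /eqP; rewrite -vpick0 => v0; exists (vpick {:V}). Qed.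

Lemma scaler_injl (F : fieldType) (V : vectType F) (v : V) (a b : F) :
  v != 0 -> a *: v = b *: v -> a = b.
Proof.
move=> v0 /eqP; rewrite -subr_eq0 -scalerBl scaler_eq0 (negPf v0) orbF subr_eq0.
by move/eqP.
Qed.

(** In the coordinates of a basis, this is the existence of a root of the
    characteristic polynomial. *)
Lemma End_eigenvalue (C : numClosedFieldType) (V : vectType C) (T : 'End(V)) :
  {:V}%VS <> 0%VS -> exists a, lker (T - a *: \1%VF) != 0%VS.
Proof.
move=> V0; have e_basis := vbasisP {:V}.
have [|a ha] :=
    eigenvalue_closed (passmx.mxof (vbasis {:V}) (vbasis {:V}) T).
  by rewrite lt0n dimv_eq0; apply/eqP.
exists a; rewrite -/(passmx.leigenspace T a) (passmx.leigenspaceE e_basis).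
by rewrite passmx.vsof_eq0.
Qed.

(** * Antilinear maps *)

Section Antilinear.
Context {R : realType} {V : vectType R[i]}.
Implicit Types (J K : V -> V) (u v : V).

Lemma antilinearD J : antilinear J -> {morph J : u v / u + v}.
Proof. by move=> aJ u v; rewrite -[u]scale1r aJ conjc1 !scale1r. Qed.

Lemma antilinear0 J : antilinear J -> J 0 = 0.
Proof.
move=> aJ; apply: (addrI (J 0)).
by rewrite -(antilinearD aJ) !addr0.
Qed.

Lemma antilinearZ J : antilinear J -> forall z v, J (z *: v) = conjc z *: J v.
Proof.
by move=> aJ z v; rewrite -[z *: v]addr0 aJ (antilinear0 aJ) addr0.
Qed.

Lemma antilinear_comp J K :
  antilinear J -> antilinear K -> linear (fun v => J (K v)).
Proof. by move=> aJ aK z u v; rewrite aK aJ conjcK. Qed.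

End Antilinear.

(** * Schur's lemma *)

Section Schur.
Context {R : realType} {g : lieAlgType R}.

(** An eigenspace of [T] is invariant and non-zero, hence everything. *)
Lemma schur (V : vectType R[i]) (rho : crep g V) (T : V -> V) :
  rep_irreducible rho -> linear T -> (forall x v, T (rho x v) = rho x (T v)) ->
  exists c, forall v, T v = c *: v.
Proof.
move=> [V0 irr] /linear_lfun[F FE] eqT.
have [c kc] := End_eigenvalue F V0; exists c => v; rewrite -FE.
case: (irr (lker (F - c *: \1%VF))) => [x u|k0|kT].
- rewrite !memv_ker !add_lfunE !opp_lfunE !scale_lfunE !id_lfunE !subr_eq0.
  by rewrite !FE eqT => /eqP->; rewrite linearZ.
- by rewrite k0 eqxx in kc.
have := memvf v; rewrite -kT memv_ker add_lfunE opp_lfunE scale_lfunE id_lfunE.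
by rewrite subr_eq0 => /eqP.
Qed.

End Schur.

(** * Antiinvolutions on irreducible representations *)

Definition kind_sign (R : realType) (k : antiinvolution_kind) : R[i] :=
  match k with FirstKind => 1 | SecondKind => -1 end.

Definition opposite_kind (k : antiinvolution_kind) : antiinvolution_kind :=
  match k with FirstKind => SecondKind | SecondKind => FirstKind end.

Lemma kind_sign_sqr (R : realType) k : kind_sign R k * kind_sign R k = 1.
Proof. by case: k; rewrite /= ?mulr1 // mulrNN mulr1. Qed.

Lemma conjc_kind_sign (R : realType) k : conjc (kind_sign R k) = kind_sign R k.
Proof. by case: k; rewrite /kind_sign ?rmorphN ?rmorph1. Qed.

Arguments kind_sign : simpl never.

Section Antiinvolution.
Context {R : realType} {g : lieAlgType R}.

Lemma antiinvolution_sqr k (V : vectType R[i]) (rho : crep g V) J :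
  antiinvolution k rho J -> forall v, J (J v) = kind_sign _ k *: v.
Proof. by case=> _ _ JJ v; rewrite JJ; case: k {JJ}; rewrite ?scale1r ?scaleN1r. Qed.

Lemma antiinvolutionI k (V : vectType R[i]) (rho : crep g V) J :
  antilinear J -> (forall x v, J (rho x v) = rho x (J v)) ->
  (forall v, J (J v) = kind_sign _ k *: v) -> antiinvolution k rho J.
Proof.
move=> aJ eJ JJ; split=> // v; rewrite JJ.
by case: k {JJ}; rewrite /kind_sign ?scale1r ?scaleN1r.
Qed.

(** Hilbert 90 for the complex numbers over the reals. The hypothesis forces
    [m * conjc m = 1], since the left-hand side is non-negative; then
    [n = 1 + m] works unless it vanishes, in which case [n = 'i] does. *)
Lemma unit_phase (m : R[i]) s : m * conjc m = kind_sign _ s ->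
  exists2 n, n != 0 & n = m * conjc n.
Proof.
move=> ms; have {ms} mm : m * conjc m = 1.
  case: s ms => //; case: m => a b /(congr1 (@complex.Re R)) /= ab.
  have {}ab : a * a - b * - b = -1 by [].
  by exfalso; nra.
have [->|m1] := eqVneq m (-1).
  exists 'i; first by rewrite eq_complex /= oner_eq0 andbF.
  by rewrite mulN1r; apply/eqP; rewrite eq_complex /= oppr0 opprK !eqxx.
exists (1 + m); first by rewrite addrC addr_eq0.
by rewrite rmorphD rmorph1 mulrDr mulr1 mm addrC.
Qed.

(** By Schur's lemma [K = m J], and [K o K] shows that [m * conjc m] is a
    sign. With [n = m * conjc n], multiplication by [n] carries [J] to [K],
    because [K (n v) = m (conjc n) (J v) = n (J v)]. *)
Lemma irreducible_antiinvolution_unique k k' (V : vectType R[i])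
    (rho : crep g V) J K : rep_irreducible rho ->
  antiinvolution k rho J -> antiinvolution k' rho K -> pair_equiv rho J rho K.
Proof.
move=> irr hJ hK; have [aJ eJ _] := hJ; have [aK eK _] := hK.
have JJ := antiinvolution_sqr hJ; have KK := antiinvolution_sqr hK.
have [c KJ] : exists c, forall v, K (J v) = c *: v.
  by apply: (schur irr (antilinear_comp aK aJ)) => x v; rewrite eJ eK.
pose m := kind_sign _ k * c.
have KE v : K v = m *: J v.
  rewrite /m -scalerA -KJ JJ (antilinearZ aK) conjc_kind_sign scalerA.
  by rewrite kind_sign_sqr scale1r.
move: m KE => {c KJ} m KE.
have [v v0] := fullv_neq0_ex (proj1 irr).
have mm : m * conjc m = kind_sign _ k * kind_sign _ k'.
  apply: (scaler_injl v0); rewrite -[RHS]scalerA -KK !KE (antilinearZ aJ) JJ.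
  rewrite !scalerA; congr (_ *: _).
  by rewrite [RHS]mulrC -!mulrA kind_sign_sqr mulr1.
have [s ms] : exists s, m * conjc m = kind_sign _ s.
  rewrite {}mm; case: k {hJ JJ m KE}; case: k' {hK KK};
    [exists FirstKind | exists SecondKind | exists SecondKind | exists FirstKind];
    by rewrite /kind_sign ?mulr1 ?mul1r ?mulrNN ?mulr1.
have [n n0 nE] := unit_phase ms.
exists (n *: \1%VF); split.
- exists (n^-1 *: \1%VF : 'End(V)) => u; rewrite !scale_lfunE !id_lfunE scalerA.
    by rewrite mulVf ?scale1r.
  by rewrite mulfV ?scale1r.
- by move=> x u; rewrite !scale_lfunE !id_lfunE linearZ.
by move=> u; rewrite !scale_lfunE !id_lfunE KE (antilinearZ aJ) scalerA -nE.
Qed.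

Lemma irreducible_is_Jrho k (V : vectType R[i]) (rho : crep g V) J :
  rep_irreducible rho -> antiinvolution k rho J -> is_Jrho rho J.
Proof.
move=> irr hJ; split; first by exists k.
by move=> k' K hK; exact: (irreducible_antiinvolution_unique irr hJ hK).
Qed.

(** An isomorphism [A] onto the conjugate is an antilinear map on [V] itself.
    Evaluating [A o A o A] in two ways shows that the scalar [c = A o A] is
    real, so dividing [A] by the square root of [|c|] leaves only the sign
    of [c]. *)
Lemma self_conjugated_antiinvolution (V : vectType R[i]) (rho : crep g V) :
  rep_irreducible rho -> self_conjugated rho ->
  exists k K, antiinvolution k rho K.
Proof.
move=> irr [f [bf ef]]; pose A : V -> V := f.
have aA : antilinear A by move=> z u v; exact: (linearP f).
have eA x v : A (rho x v) = rho x (A v).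
  by rewrite /A ef /= /conj_rep_fun lfunE.
have [c AA] : exists c, forall v, A (A v) = c *: v.
  by apply: (schur irr (antilinear_comp aA aA)) => x v; rewrite !eA.
have Ainj : injective A := bij_inj bf.
have [v v0] := fullv_neq0_ex (proj1 irr).
have Av0 : A v != 0 by rewrite -[0](antilinear0 aA) (inj_eq Ainj).
have c0 : c != 0.
  apply: contraNneq Av0 => c0; apply/eqP/Ainj.
  by rewrite AA c0 scale0r (antilinear0 aA).
have cc : conjc c = c.
  by apply: (scaler_injl Av0); rewrite -(antilinearZ aA) -!AA.
have [r cE] : exists r : R, c = r%:C.
  case: c cc {AA c0} => a b /eqP; rewrite eq_complex /= eqxx /= => /eqP b0.
  by exists a; congr (_ +i* _); lra.
have r0 : r != 0 by apply: contraNneq c0; rewrite cE => ->.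
pose s := Num.sqrt `|r|.
have s2 : s * s = `|r| by rewrite -expr2 sqr_sqrtr.
have [k rk] : exists k, r%:C = kind_sign R k * `|r|%:C.
  have [r_ge0|r_lt0] := lerP 0 r.
    by exists FirstKind; rewrite ger0_norm // /kind_sign mul1r.
  by exists SecondKind; rewrite ltr0_norm // /kind_sign mulN1r rmorphN opprK.
exists k, (fun v => (s^-1)%:C *: A v); apply: antiinvolutionI.
- by move=> z u w; rewrite aA scalerDr !scalerA mulrC.
- by move=> x w; rewrite eA linearZ.
move=> w; rewrite (antilinearZ aA) AA !scalerA conjc_real cE; congr (_ *: _).
rewrite rk mulrCA -!rmorphM /= -[s^-1 * s^-1]invfM s2 mulVf ?normr_eq0 //.
by rewrite mulr1.
Qed.

End Antiinvolution.

(** * Subrepresentations *)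

Lemma conj_rep_funE (R : realType) (g : lieAlgType R) (V : vectType R[i])
    (rho : crep g V) x (v : V) :
  conj_rep_fun rho x (v : conj_space V) = rho x v.
Proof. by rewrite lfunE. Qed.

Lemma dsum_repE (R : realType) (g : lieAlgType R) (V W : vectType R[i])
    (rho : crep g V) (sigma : crep g W) x (p : V * W) :
  dsum_rep rho sigma x p = (rho x p.1, sigma x p.2).
Proof. by rewrite lfunE. Qed.

Section SubRep.
Context {R : realType} {g : lieAlgType R} {V : vectType R[i]} (rho : crep g V).

Lemma minimal_invariant (U : {vspace V}) :
  rep_invariant rho U -> U <> 0%VS ->
  exists W : {vspace V}, [/\ rep_invariant rho W, W <> 0%VS, (W <= U)%VS &
    forall X : {vspace V}, rep_invariant rho X -> (X <= W)%VS ->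
      X = 0%VS \/ X = W].
Proof.
have [n] := ubnP (\dim U); elim: n U => // n IHn U dU invU U0.
have [[X [invX X0 XU XnU]]|minU] := classic (exists X : {vspace V},
    [/\ rep_invariant rho X, X <> 0%VS, (X <= U)%VS & X <> U]).
  have [|//|//|W [invW W0 WX minW]] := IHn X.
    suff dX : (\dim X < \dim U)%N by exact: leq_trans dX dU.
    rewrite (ltn_leqif (dimv_leqif_sup XU)).
    by apply/negP => UX; case: XnU; apply/eqP; rewrite eqEsubv XU.
  by exists W; split=> //; apply: subv_trans WX XU.
exists U; split=> // X invX XU.
have [X0|X0] := classic (X = 0%VS); first by left.
right; apply: NNPP => XnU.
by apply: minU; exists X.
Qed.

Variables (U : {vspace V}) (invU : rep_invariant rho U).

Definition sub_rep_fun (x : g) : 'End(subvs_of U) :=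
  linfun (vsproj U \o rho x \o vsval).

Lemma sub_rep_funE x u : vsval (sub_rep_fun x u) = rho x (vsval u).
Proof. by rewrite lfunE /= vsprojK //; apply/invU/subvsP. Qed.

Fact sub_rep_linear (a : R) (x y : g) :
  sub_rep_fun (a *: x + y) = a%:C *: sub_rep_fun x + sub_rep_fun y.
Proof.
apply/lfunP=> u; apply: subvs_inj; rewrite add_lfunE scale_lfunE linearP /=.
by rewrite !sub_rep_funE crep_linear add_lfunE scale_lfunE.
Qed.

Fact sub_rep_lie (x y : g) :
  sub_rep_fun (lie x y) =
    (sub_rep_fun x \o sub_rep_fun y)%VF - (sub_rep_fun y \o sub_rep_fun x)%VF.
Proof.
apply/lfunP=> u; apply: subvs_inj; rewrite add_lfunE opp_lfunE !comp_lfunE.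
rewrite linearB /= !sub_rep_funE crep_lie add_lfunE opp_lfunE.
by rewrite !comp_lfunE.
Qed.

Definition sub_rep : crep g (subvs_of U) := CRep sub_rep_linear sub_rep_lie.

(** Invariant subspaces of [U] as a representation are, through the inclusion,
    the invariant subspaces of [V] contained in [U]. *)
Lemma sub_rep_irreducible : U <> 0%VS ->
  (forall X : {vspace V}, rep_invariant rho X -> (X <= U)%VS ->
     X = 0%VS \/ X = U) ->
  rep_irreducible sub_rep.
Proof.
move=> U0 minU; split.
  move=> F0; apply: U0; apply/eqP; rewrite -vpick0; apply/eqP.
  have: vsproj U (vpick U) \in 0%VS by rewrite -F0 memvf.
  by rewrite memv0 => /eqP /(congr1 vsval); rewrite vsprojK ?memv_pick // linear0.
move=> X invX; pose i := linfun (vsval : subvs_of U -> V).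
have iE u : i u = vsval u by rewrite lfunE.
have memX u : vsval u \in (i @: X)%VS -> u \in X.
  by case/memv_imgP=> w wX; rewrite iE => /subvs_inj->.
case: (minU (i @: X)%VS) => [x _ /memv_imgP[u uX ->]||X0|XU].
- by rewrite iE -sub_rep_funE -iE memv_img // (invX x u).
- by apply/subvP=> _ /memv_imgP[u _ ->]; rewrite iE subvsP.
- left; apply/eqP; rewrite -subv0; apply/subvP=> u /(memv_img i).
  by rewrite X0 !memv0 iE => /eqP u0; apply/eqP/subvs_inj; rewrite u0 linear0.
right; apply/vspaceP=> u; rewrite memvf.
by apply: memX; rewrite XU subvsP.
Qed.

End SubRep.

(** * Irreducible pairs with a proper invariant subspace *)

Section Pairs.
Context {R : realType} {g : lieAlgType R}.

Lemma pair_equiv_refl (V : vectType R[i]) (rho : crep g V) J :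
  pair_equiv rho J rho J.
Proof.
exists \1%VF; split=> *; rewrite ?id_lfunE //.
by exists id => v; rewrite id_lfunE.
Qed.

Lemma pair_equiv_sym (V W : vectType R[i]) (rho : crep g V) J
    (sigma : crep g W) K :
  pair_equiv rho J sigma K -> pair_equiv sigma K rho J.
Proof.
case=> f [bf ef fJ]; have fI := bij_inj bf.
have fK : cancel f (f^-1)%VF by apply/lker0_lfunK/lker0P.
have Kf : cancel (f^-1)%VF f by have [h _ hK] := bf; move=> w; rewrite -[w]hK fK.
exists (f^-1)%VF; split; first by exists f.
  by move=> x w; apply: fI; rewrite ef !Kf.
by move=> w; apply: fI; rewrite fJ !Kf.
Qed.

Definition conj_swap (k : antiinvolution_kind) (W : vectType R[i]) :
    W * conj_space W -> W * conj_space W :=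
  match k with FirstKind => @J_R R W | SecondKind => @J_H R W end.

Variables (k : antiinvolution_kind) (V : vectType R[i]) (rho : crep g V).
Variable (J : V -> V).
Hypotheses (hJ : antiinvolution k rho J) (irrJ : pair_irreducible rho J).
Variable (U : {vspace V}).
Hypotheses (invU : rep_invariant rho U).
Hypotheses (U0 : U <> 0%VS) (UV : U <> {:V}%VS).

Let aJ : antilinear J. Proof. by case: hJ. Qed.
Let eJ x v : J (rho x v) = rho x (J v). Proof. by case: hJ. Qed.
Let JJ := antiinvolution_sqr hJ.

(** The vectors [v] with [v] and [J v] in [U] form the intersection of [U] with
    [J U], which is invariant under [rho] and [J] and not the whole space. *)
Lemma invariant_cap_J v : v \in U -> J v \in U -> v = 0.
Proof.
move=> vU JvU.
(* On the conjugate space the antilinear map [J] becomes linear, which makes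
   [J U] available as the image of [G]. *)
have [G GE] : exists G : 'Hom(conj_space (subvs_of U), V),
    forall u : subvs_of U, G u = J (vsval u).
  have lG : linear (fun u : conj_space (subvs_of U) => J (vsval (u : subvs_of U))).
    by move=> z u w; rewrite conj_scaleE linearP /= aJ conjcK.
  by have [G GE] := linear_lfun lG; exists G.
have memG w : (w \in limg G) = (J w \in U).
  apply/memv_imgP/idP => [[u _ ->]|JwU].
    by rewrite (GE u) JJ memvZ // subvsP.
  exists (vsproj U (kind_sign R k *: J w)); first exact: memvf.
  rewrite (GE (vsproj U _)) vsprojK ?memvZ // (antilinearZ aJ) conjc_kind_sign.
  by rewrite JJ scalerA kind_sign_sqr scale1r.
case: (proj2 irrJ (U :&: limg G)%VS) => [x w|w|cap0|capT].
- by rewrite !memv_cap !memG => /andP[wU JwU]; rewrite eJ !invU.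
- by rewrite !memv_cap !memG => /andP[wU JwU]; rewrite JJ JwU memvZ.
- by apply/eqP; rewrite -memv0 -cap0 memv_cap memG vU.
by case: UV; apply/eqP; rewrite eqEsubv subvf -capT capvSl.
Qed.

(** The isomorphism is [(u1, u2) |-> u1 + J u2]: it is injective because [U]
    meets [J U] trivially, and onto because its image is invariant under [rho]
    and [J]. *)
Lemma pair_equiv_dsum : let phi := sub_rep invU in
  pair_equiv rho J (dsum_rep phi (conj_rep phi)) (conj_swap k (W := _)).
Proof.
move=> phi; apply: pair_equiv_sym.
pose f (p : subvs_of U * conj_space (subvs_of U)) : V :=
  vsval p.1 + J (vsval (p.2 : subvs_of U)).
have [F FE] : exists F : 'Hom(_, _), F =1 f.
  apply: linear_lfun => z p q; rewrite /f /= aJ conjcK.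
  by rewrite scalerDr addrACA.
have eF x p : F (dsum_rep phi (conj_rep phi) x p) = rho x (F p).
  by rewrite !FE dsum_repE /f /= conj_rep_funE !(sub_rep_funE invU) eJ linearD.
have FJ p : F (conj_swap k p) = J (F p).
  rewrite !FE /f (antilinearD aJ) JJ [RHS]addrC.
  by case: k; rewrite /kind_sign /= ?scale1r ?scaleN1r ?linearN.
have Finj : injective F.
  apply/lker0P; rewrite -subv0; apply/subvP=> p; rewrite memv_ker memv0 FE /f.
  rewrite addr_eq0 => /eqP p1E; have p2 : vsval (p.2 : subvs_of U) = 0.
    apply: invariant_cap_J (subvsP _) _.
    by rewrite -[J _]opprK -p1E memvN subvsP.
  move: p1E; rewrite p2 (antilinear0 aJ) oppr0 => p1.
  rewrite -pair_eqE /pair_eq /=; apply/andP; split; apply/eqP/subvs_inj.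
    by rewrite p1 linear0.
  by rewrite p2 linear0.
have imF : limg F = {:V}%VS.
  case: (proj2 irrJ (limg F)) => [x _ /memv_imgP[p _ ->]|_ /memv_imgP[p _ ->]||//].
  - by rewrite -eF memv_img ?memvf.
  - by rewrite -FJ memv_img ?memvf.
  move=> F0; case: U0; apply/eqP; rewrite -subv0; apply/subvP=> u uU.
  have := memv_img F (memvf (vsproj U u, 0)); rewrite F0 FE /f /= vsprojK //.
  by rewrite (antilinear0 aJ) addr0.
by exists F; split=> //; apply: lfun_bijective.
Qed.

(** If [K] had the kind of [J], with common sign [eps], then
    [J (u + J (K u)) = J u + eps (K u)] would again have the form
    [w + J (K w)], for [w = eps (K u)]; these vectors would thus form an
    invariant subspace, non-zero and of dimension at most that of [U]. *)
Lemma sub_rep_opposite_kind k' K :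
  antiinvolution k' (sub_rep invU) K -> k' = opposite_kind k.
Proof.
move=> hK; have [kk'|//] : k = k' \/ k' = opposite_kind k.
  by case: (k); case: k' {hK}; [left|right|right|left].
subst k'; have [aK eK _] := hK; have KK := antiinvolution_sqr hK.
have [H HE] : exists H : 'Hom(subvs_of U, V),
    forall u, H u = vsval u + J (vsval (K u)).
  apply: linear_lfun => z u w.
  by rewrite aK !linearP /= aJ conjcK scalerDr addrACA.
case: (proj2 irrJ (limg H)) => [x _ /memv_imgP[u _ ->]|_ /memv_imgP[u _ ->]||].
- have -> : rho x (H u) = H (sub_rep invU x u).
    by rewrite !HE eK !(sub_rep_funE invU) eJ linearD.
  by rewrite memv_img ?memvf.
- have -> : J (H u) = H (kind_sign R k *: K u).
    rewrite !HE (antilinearD aJ) JJ (antilinearZ aK) conjc_kind_sign KK.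
    by rewrite scalerA kind_sign_sqr scale1r linearZ addrC.
  by rewrite memv_img ?memvf.
- move=> H0; case: U0; apply/eqP; rewrite -subv0; apply/subvP=> u uU.
  have := memv_img H (memvf (vsproj U u)); rewrite H0 !memv0 HE vsprojK //.
  rewrite addrC addr_eq0 => /eqP JE.
  have K0 : vsval (K (vsproj U u)) = 0.
    by apply: invariant_cap_J (subvsP _) _; rewrite JE memvN.
  by move: JE; rewrite K0 (antilinear0 aJ) => /esym/eqP; rewrite oppr_eq0.
move=> HT; case: UV; apply/eqP; rewrite eqEdim subvf -HT.
have /(leq_trans (leq_addl _ _)) := eq_leq (limg_ker_dim H {:_}).
by rewrite dimvf.
Qed.

End Pairs.

(** * The classification *)

Lemma pair_irreducible_classification (R : realType) (g : lieAlgType R) k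
    (V : vectType R[i]) (rho : crep g V) (J : V -> V) :
  antiinvolution k rho J -> pair_irreducible rho J ->
  rep_irreducible rho \/
  exists (W : vectType R[i]) (phi : crep g W),
    [/\ rep_irreducible phi,
        (exists K, antiinvolution (opposite_kind k) phi K) \/
          ~ self_conjugated phi
      & pair_equiv rho J (dsum_rep phi (conj_rep phi)) (conj_swap k (W := W))].
Proof.
move=> hJ irrJ; have [irr|nirr] := classic (rep_irreducible rho); first by left.
right; have [V0 _] := irrJ.
have [X [invX X0 XV]] : exists X : {vspace V},
    [/\ rep_invariant rho X, X <> 0%VS & X <> {:V}%VS].
  apply: NNPP => noX; apply: nirr; split=> // X invX.
  apply: NNPP => /not_or_and[X0 XV]; apply: noX.
  by exists X.
have [U [invU U0 UX minU]] := minimal_invariant invX X0.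
have UV : U <> {:V}%VS.
  by move=> UV; apply: XV; apply/eqP; rewrite eqEsubv subvf -UV.
have irrU := sub_rep_irreducible invU U0 minU.
exists (subvs_of U), (sub_rep invU); split=> //; last exact: pair_equiv_dsum.
have [sc|] := classic (self_conjugated (sub_rep invU)); last by right.
left; have [k' [K hK]] := self_conjugated_antiinvolution irrU sc.
by exists K; rewrite -(sub_rep_opposite_kind hJ irrJ U0 UV hK).
Qed.

Theorem theorem4p16 (R : realType) (g : lieAlgType R) (hg : semisimple g) :
  (forall (V : vectType (complex R)) (rho : crep g V) (J : V -> V),
     is_Hrep rho J -> pair_irreducible rho J ->
     (exists (W : vectType (complex R)) (sigma : crep g W) (K : W -> W),
        rep_irreducible sigma /\ quaternionic_rep sigma /\
        is_Jrho sigma K /\ pair_equiv rho J sigma K) \/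
     (exists (W : vectType (complex R)) (phi : crep g W),
        rep_irreducible phi /\ (real_rep phi \/ ~ self_conjugated phi) /\
        pair_equiv rho J (dsum_rep phi (conj_rep phi)) (@J_H R W)))
  /\
  (forall (V : vectType (complex R)) (rho : crep g V) (J : V -> V),
     is_Rrep rho J -> pair_irreducible rho J ->
     (exists (W : vectType (complex R)) (sigma : crep g W) (K : W -> W),
        rep_irreducible sigma /\ real_rep sigma /\
        is_Jrho sigma K /\ pair_equiv rho J sigma K) \/
     (exists (W : vectType (complex R)) (phi : crep g W),
        rep_irreducible phi /\ (quaternionic_rep phi \/ ~ self_conjugated phi) /\
        pair_equiv rho J (dsum_rep phi (conj_rep phi)) (@J_R R W))).
Proof.
split=> V rho J hJ irrJ.
- have [irr|[W [phi [irr hphi eqv]]]] :=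
    @pair_irreducible_classification _ _ SecondKind _ _ _ hJ irrJ.
    left; exists V, rho, J; split=> //; split; first by exists J.
    split; last exact: pair_equiv_refl.
    exact: (@irreducible_is_Jrho _ _ SecondKind).
  by right; exists W, phi.
have [irr|[W [phi [irr hphi eqv]]]] :=
  @pair_irreducible_classification _ _ FirstKind _ _ _ hJ irrJ.
  left; exists V, rho, J; split=> //; split; first by exists J.
  split; last exact: pair_equiv_refl.
  exact: (@irreducible_is_Jrho _ _ FirstKind).
by right; exists W, phi.
Qed.
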